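(* Let $q\ge1$ and $0\le u<v$. Let $\psi:[u,v]\subset\mathbb{R}_+\to\mathbb{R}$ be differentiable on $(u,v)$ with $\psi'\in L_1[u,v]$, and suppose $|\psi'|^{q}$ is convex on $[u,v]$. Then $$\left|\frac{\psi(u)+\psi(v)}{2}-\frac{1}{v-u}\int_u^v\psi(x)\,dx\right|\le\frac{v-u}{2}\left(\frac{|\psi'(u)|^{q}+|\psi'(v)|^{q}}{2}\right)^{\frac1q}.$$
   Context: $\mathbb{R}_+=[0,\infty)$; $\psi'$ at the endpoints is understood as the one-sided derivative. *)

(* Defs.v *)
From HB Require Import structures.
From mathcomp Require Export all_boot all_order all_algebra.
From mathcomp Require Export all_classical all_reals all_analysis.
Export Order.TTheory GRing.Theory Num.Theory.
Export numFieldNormedType.Exports.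

Set Implicit Arguments.
Unset Strict Implicit.
Unset Printing Implicit Defensive.

Local Open Scope classical_set_scope.
Local Open Scope ring_scope.

Definition right_derivable (R : realType) (f : R -> R) (a : R) : Prop :=
  cvg (h^-1 *: (f (h + a) - f a) @[h --> 0^'+]).

Definition left_derivable (R : realType) (f : R -> R) (a : R) : Prop :=
  cvg (h^-1 *: (f (h + a) - f a) @[h --> 0^'-]).

Definition right_derive (R : realType) (f : R -> R) (a : R) : R :=
  lim (h^-1 *: (f (h + a) - f a) @[h --> 0^'+]).

Definition left_derive (R : realType) (f : R -> R) (a : R) : R :=
  lim (h^-1 *: (f (h + a) - f a) @[h --> 0^'-]).

(* The derivative of a function on [u, v]. On [u, v] it depends only on the
   restriction of f to [u, v]; the value outside [u, v] is irrelevant.        *)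
Definition derive_itv (R : realType) (u v : R) (f : R -> R) (x : R) : R :=
  if x == u then right_derive f u
  else if x == v then left_derive f v
  else derive1 f x.

(* Main.v *)
Require Import Defs.
From mathcomp Require Import lra ring.

(** Write [A = |psi'(u)|^q], [B = |psi'(v)|^q], [M = (A + B) / 2] and
    [c = M^(1/q)].  For each [x] in [[u, v]],

      |(psi u + psi v) / 2 - psi x|
        <= (|psi x - psi u| + |psi v - psi x|) / 2,

    so it suffices to bound the variation of [psi] through [x] by
    [c (v - u)]: averaging over [x] then gives the theorem
    ([ler_dist_mean_Rintegral]), and no integral of [psi'] occurs.

    To bound this variation, convexity puts [|psi'|^q] below its chord
    ([convex_function_le_chord]), an affine function with value [M] at the
    midpoint.  The concave function [t |-> t^(1/q)] lies below its tangent
    at [M] ([powR_inv_le_tangent]), and composing the two gives an affine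
    bound [|psi' x| <= c + k (x - (u + v) / 2)].  Let [P] be a primitive of the
    right-hand side.  By the mean value theorem increments of [psi] are
    dominated by increments of [P] ([ler_dist_of_derive_le]), and
    [P v - P u = c (v - u)], because the slope term is odd about the midpoint. *)

Set Implicit Arguments.
Unset Strict Implicit.
Unset Printing Implicit Defensive.

Local Open Scope classical_set_scope.
Local Open Scope ring_scope.

(** Young's inequality applied to [s] and [1], with exponents [q] and
    [q / (q - 1)]; the case [q = 1], which has no finite conjugate exponent, is
    an equality. *)
Lemma powR_bernoulli (R : realType) (q s : R) :
  1 <= q -> 0 <= s -> 1 + q * (s - 1) <= s `^ q.
Proof.
move=> q1 s0; have [->|qn1] := eqVneq q 1; first by rewrite powRr1//; lra.
have {qn1}q1' : 1 < q by rewrite lt_neqAle eq_sym qn1.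
have q0 : 0 < q by lra.
pose p := q / (q - 1).
have p0 : 0 < p by rewrite divr_gt0//; lra.
have qp : q^-1 + p^-1 = 1 by rewrite /p; field; lra.
have := conjugate_powR s0 ler01 q0 p0 qp.
rewrite powR1 mulr1 mul1r (_ : p^-1 = 1 - q^-1); last by rewrite -qp; ring.
rewrite -(ler_pM2l q0) mulrDr mulrBr mulr1 mulrCA !mulfV ?gt_eqF// mulr1; lra.
Qed.

(** Concavity of [t |-> t^(1/q)], evaluated at [t = a^q]: the right-hand side is
    the tangent at [M].  It is Bernoulli's inequality for [a / M^(1/q)],
    rescaled. *)
Lemma powR_inv_le_tangent (R : realType) (q a M : R) :
  1 <= q -> 0 <= a -> 0 < M ->
  a <= M `^ q^-1 + M `^ q^-1 / (q * M) * (a `^ q - M).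
Proof.
move=> q1 a0 M0; have q0 : 0 < q by lra.
set c := M `^ q^-1; have c0 : 0 < c by exact: powR_gt0.
have cq : c `^ q = M by rewrite /c -powRrM mulVf ?gt_eqF// powRr1// ltW.
have s0 : 0 <= a / c by rewrite divr_ge0// ltW.
have := powR_bernoulli q1 s0; set s := a / c.
have -> : a = s * c by rewrite /s divfK ?gt_eqF.
rewrite powRM ?(ltW c0)// cq => sq.
have -> : c + c / (q * M) * (s `^ q * M - M) = (1 + (s `^ q - 1) / q) * c.
  by field; rewrite !gt_eqF.
by rewrite ler_pM2r// -lerBlDl ler_pdivlMr//; lra.
Qed.

(** The increment is [h] times the slope, and a convergent slope stays bounded
    as [h] tends to 0.  The filter [F] is a parameter in order to cover both
    one-sided limits. *)
Lemma cvg_of_cvg_slope (R : realType) (f : R -> R) (a : R)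
    (F : set_system R) {FF : ProperFilter F} :
  F `=>` 0^' -> cvg (h^-1 *: (f (h + a) - f a) @[h --> F]) ->
  f (h + a) @[h --> F] --> f a.
Proof.
move=> F0 df.
have F0' : h @[h --> F] --> (0 : R).
  by move=> A A0; apply: F0; exact: nbhs_dnbhs A0.
have := cvgD (cvgM F0' df) (cvg_cst (f a) (F := F)).
rewrite mul0r add0r => /(_ _ _ _); apply: cvg_trans; apply: near_eq_cvg.
have : \forall h \near F, h != 0 by apply: F0; exact: withinT.
apply: filterS => h h0 /=; rewrite /GRing.scale/=.
rewrite [LHS](_ : _ = h * (h^-1 * (f (h + a) - f a)) + f a)//.
by rewrite mulVKf// subrK.
Qed.

Lemma right_derivable_continuous (R : realType) (f : R -> R) (a : R) :
  right_derivable f a -> f x @[x --> a^'+] --> f a.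
Proof.
move=> df.
have H : f (h + a) @[h --> 0^'+] --> f a.
  apply: (cvg_of_cvg_slope _ df) => A;
    apply: (@filterS _ (nbhs (0 : R))) => h hA h0.
  by apply: hA; rewrite gt_eqF.
move=> A /H HA; apply/nbhs_right0P.
have {}HA : \forall h \near 0^'+, A (f (h + a)) by exact: HA.
by apply: filterS HA => h; rewrite addrC.
Qed.

Lemma left_derivable_continuous (R : realType) (f : R -> R) (a : R) :
  left_derivable f a -> f x @[x --> a^'-] --> f a.
Proof.
move=> df.
have H : f (h + a) @[h --> 0^'-] --> f a.
  apply: (cvg_of_cvg_slope _ df) => A;
    apply: (@filterS _ (nbhs (0 : R))) => h hA h0.
  by apply: hA; rewrite lt_eqF.
move=> A /H HA; apply/nbhs_left0P.
have /nbhs_left0P {}HA : \forall h \near 0^'-, A (f (h + a)) by exact: HA.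
by apply: filterS HA => h; rewrite sub0r addrC.
Qed.

(** Both [g - f] and [g + f] have a nonnegative derivative, hence are
    nondecreasing. *)
Lemma ler_dist_of_derive_le (R : realType) (f g : R -> R) (a b : R) :
  {within `[a, b], continuous f} -> {within `[a, b], continuous g} ->
  (forall x, x \in `]a, b[ -> derivable f x 1) ->
  (forall x, x \in `]a, b[ -> derivable g x 1) ->
  (forall x, x \in `]a, b[ -> `|derive1 f x| <= derive1 g x) ->
  forall x y, a <= x -> x <= y -> y <= b -> `|f y - f x| <= g y - g x.
Proof.
move=> cf cg df dg fg x y ax xy yb.
have xab : x \in `[a, b] by rewrite in_itv/= ax (le_trans xy).
have yab : y \in `[a, b] by rewrite in_itv/= yb (le_trans ax).
have gBf : g x - f x <= g y - f y.
  apply: (@ger0_derive1_le_cc R (g - f) a b _ _ _ x y xab yab xy).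
  - by move=> z zab; exact: derivableB (dg _ zab) (df _ zab).
  - move=> z zab; rewrite derive1E (deriveB (dg _ zab) (df _ zab)) -!derive1E.
    by have := fg _ zab; rewrite ler_norml => /andP[]; lra.
  - by move=> z; apply: cvgB; [exact: cg|exact: cf].
have gDf : g x + f x <= g y + f y.
  apply: (@ger0_derive1_le_cc R (g + f) a b _ _ _ x y xab yab xy).
  - by move=> z zab; exact: derivableD (dg _ zab) (df _ zab).
  - move=> z zab; rewrite derive1E (deriveD (dg _ zab) (df _ zab)) -!derive1E.
    by have := fg _ zab; rewrite ler_norml => /andP[]; lra.
  - by move=> z; apply: cvgD; [exact: cg|exact: cf].
by rewrite ler_norml; apply/andP; split; lra.
Qed.

(** The chord is written around its midpoint because the bound on the
    derivative is later linearized there. *)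
Lemma convex_function_le_chord (R : realType) (f : R -> R) (u v x : R) :
  u < v -> convex_function (`[u, v]%classic : set R) f -> u <= x <= v ->
  f x <= (f u + f v) / 2 + (f v - f u) / (v - u) * (x - (u + v) / 2).
Proof.
move=> uv cvx /andP[ux xv].
have t0 : 0 <= (v - x) / (v - u) by rewrite divr_ge0//; lra.
have t1 : (v - x) / (v - u) <= 1 by rewrite ler_pdivrMr; lra.
have uI : u \in (`[u, v]%classic : set R) by rewrite inE/= in_itv/= lexx ltW.
have vI : v \in (`[u, v]%classic : set R) by rewrite inE/= in_itv/= lexx ltW.
have := cvx (Itv01 t0 t1) u v uI vI.
rewrite !convRE/= /unstable.onem.
have -> : conv (Itv01 t0 t1) (u : convex_lmodType R) v = x.
  rewrite [LHS](_ : _ = (v - x) / (v - u) * u + (1 - (v - x) / (v - u)) * v)//.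
  by field; lra.
move/le_trans; apply; rewrite le_eqVlt; apply/orP; left; apply/eqP.
by field; lra.
Qed.

Lemma ler_dist_mean_Rintegral (R : realType) (f : R -> R) (u v c k : R) :
  u < v -> {within `[u, v], continuous f} ->
  (forall x, x \in `[u, v] -> `|c - f x| <= k) ->
  `|c - (v - u)^-1 * \int[@lebesgue_measure R]_(x in `[u, v]) f x| <= k.
Proof.
move=> uv cf fk; have vu0 : 0 < v - u by rewrite subr_gt0.
pose mu := @lebesgue_measure R.
have intc (d : R) : mu.-integrable `[u, v] (EFin \o cst d).
  apply: continuous_compact_integrable; first exact: segment_compact.
  by move=> x; exact: cvg_cst.
have intf : mu.-integrable `[u, v] (EFin \o f).
  by apply: continuous_compact_integrable => //; exact: segment_compact.
have muE : fine (mu `[u, v]%classic) = v - u.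
  by rewrite /mu lebesgue_measure_itv/= lte_fin uv.
have le1 : (c - k) * (v - u) <= \int[mu]_(x in `[u, v]) f x.
  rewrite -muE -Rintegral_cst//; apply: le_Rintegral => // [|x xuv].
    exact: intc.
  by have := fk x xuv; rewrite ler_norml => /andP[]; lra.
have le2 : \int[mu]_(x in `[u, v]) f x <= (c + k) * (v - u).
  rewrite -muE -Rintegral_cst//; apply: le_Rintegral => // [|x xuv].
    exact: intc.
  by have := fk x xuv; rewrite ler_norml => /andP[]; lra.
rewrite -ler_pdivlMr// in le1; rewrite -ler_pdivrMr// in le2.
rewrite -/mu; move: (Rintegral _ _ _) le1 le2 => I le1 le2.
by rewrite ler_norml [_^-1 * _]mulrC; apply/andP; split; lra.
Qed.

Theorem corollary2 (R : realType) (q u v : R) (psi : R -> R)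
  (hq : 1 <= q) (hu : 0 <= u) (huv : u < v)
  (hdiff : forall x : R, u < x < v -> derivable psi x 1)
  (hdiffu : right_derivable psi u)
  (hdiffv : left_derivable psi v)
  (hL1 : (@lebesgue_measure R).-integrable `[u, v]
           (EFin \o derive_itv u v psi))
  (hconv : convex_function (`[u, v]%classic : set R)
             (fun x : R => `|derive_itv u v psi x| `^ q)) :
  `|(psi u + psi v) / 2
      - (v - u)^-1 * \int[@lebesgue_measure R]_(x in `[u, v]) psi x|
  <= (v - u) / 2
     * ((`|derive_itv u v psi u| `^ q + `|derive_itv u v psi v| `^ q) / 2)
         `^ q^-1.
Proof.
have q0 : 0 < q by lra.
have chord x := convex_function_le_chord (x := x) huv hconv.
move: chord; cbv beta.
set A := `|derive_itv u v psi u| `^ q; set B := `|derive_itv u v psi v| `^ q.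
set M := (A + B) / 2; set c := M `^ q^-1 => chord.
have A0 : 0 <= A by exact: powR_ge0.
have B0 : 0 <= B by exact: powR_ge0.
have psic : {within `[u, v], continuous psi}.
  apply/continuous_within_itvP => //; split.
  - move=> x; rewrite in_itv/= => /hdiff/derivable1_diffP.
    exact: differentiable_continuous.
  - exact: right_derivable_continuous.
  - exact: left_derivable_continuous.
have [k dpsi] : exists k, forall x, u < x < v ->
    `|derive1 psi x| <= c + k * (x - (u + v) / 2).
  have dE x : u < x < v -> derive_itv u v psi x = derive1 psi x.
    by move=> /andP[ux xv]; rewrite /derive_itv gt_eqF// lt_eqF.
  (* If [M = 0], the tangent to [t^(1/q)] at [M] may be vertical; but then
     [A = B = 0], so [psi'] vanishes on the interval and slope 0 will do. *)
  have [M0|M0] := leP M 0.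
    have {}M0 : (A + B) / 2 <= 0 by exact: M0.
    have A_eq0 : A = 0 by lra.
    have B_eq0 : B = 0 by lra.
    have M_eq0 : M = 0 by rewrite /M A_eq0 B_eq0 addr0 mul0r.
    exists 0 => x xuv; have := chord x.
    have -> : u <= x <= v by case/andP: xuv => /ltW -> /ltW ->.
    rewrite dE// A_eq0 B_eq0 M_eq0 subrr !mul0r addr0 => /(_ isT).
    rewrite le_eqVlt ltNge powR_ge0 orbF => /eqP/powR_eq0_eq0 ->.
    by rewrite addr0 powR_ge0.
  (* The slope of the tangent to [t^(1/q)] at [M], times that of the chord. *)
  exists (c / (q * M) * ((B - A) / (v - u))) => x xuv.
  apply: le_trans (powR_inv_le_tangent hq (normr_ge0 _) M0) _.
  rewrite -/c lerD2l -[leRHS]mulrA ler_wpM2l//.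
    by rewrite divr_ge0 ?powR_ge0// mulr_ge0// ltW.
  rewrite lerBlDl -dE//; apply: chord.
  by case/andP: xuv => /ltW -> /ltW ->.
pose P x : R := c * x + k / 2 * (x - (u + v) / 2) ^+ 2.
have isP (x : R) : is_derive x (1 : R) P (c + k * (x - (u + v) / 2)).
  have -> : P = c \*o id + (k / 2) \*o (fun y => (y - (u + v) / 2) ^+ 2).
    by apply/funext.
  apply: is_derive_eq.
  by rewrite /GRing.scale/=; field.
have dist := @ler_dist_of_derive_le R psi P u v psic.
have /dist{}dist : {within `[u, v], continuous P}.
  by apply: derivable_within_continuous => x _; exact: ex_derive.
have {}dist : forall x y, u <= x -> x <= y -> y <= v ->
    `|psi y - psi x| <= P y - P x.
  apply: dist => x; rewrite in_itv/= => xuv.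
  - exact: hdiff.
  - exact: ex_derive.
  - by rewrite [derive1 P _]derive1E derive_val; exact: dpsi.
apply: ler_dist_mean_Rintegral => // x; rewrite in_itv/= => /andP[ux xv].
have := dist _ _ (lexx u) ux xv; have := dist _ _ ux xv (lexx v).
have PE : P v - P u = c * (v - u) by rewrite /P; field.
rewrite !ler_norml => /andP[d1 d2] /andP[d3 d4].
by apply/andP; split; lra.
Qed.
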